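(* Let $G$ be a connected graph with $n \geq 4$ vertices, where $G$ is not a tree. Then $$n + \left\lceil \frac{n}{2} \right\rceil - 1 \leq \gamma_{c}(M(G)) + \tilde{\gamma}_{c}(M(G)) \leq 2n-2,$$ and $$\left\lceil \frac{n}{2} \right\rceil (n-1) \leq \gamma_{c}(M(G)) \cdot \tilde{\gamma}_{c}(M(G)) \leq (n-1)^{2}.$$
   Context: All graphs are non-empty, finite, undirected and simple. A dominating set of a graph $H$ is a set $S \subseteq V(H)$ such that $N_H[v] \cap S \neq \emptyset$ for every $v \in V(H)$, where $N_H[v]$ is the closed neighborhood of $v$. A dominating set $S$ of $H$ is a connected dominating set if the induced subgraph $H[S]$ is connected, and an outer-connected dominating set if the graph $H - S$ (obtained by deleting the vertices in $S$) is connected. The connected domination number $\gamma_c(H)$ and the outer-connected domination number $\tilde{\gamma}_c(H)$ are the minimum cardinalities of a connected dominating set and of an outer-connected dominating set of $H$, respectively. The middle graph $M(G)$ of a graph $G$ is the graph with vertex set $V(G) \cup E(G)$ (disjoint union), in which two vertices $x,y$ are adjacent if and only if either $x,y \in E(G)$ are distinct edges sharing an endpoint in $G$, or one of them is a vertex of $G$ and the other is an edge of $G$ incident with it. *)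

(* Defs.v *)
From mathcomp Require Import all_boot.

Set Implicit Arguments.
Unset Strict Implicit.
Unset Printing Implicit Defensive.

Record sgraph := SGraph {
  vertex :> finType;
  adj : rel vertex;
  adj_sym : symmetric adj;
  adj_irrefl : irreflexive adj
}.

Definition edges (G : sgraph) : {set {set G}} :=
  [set A | [exists x, exists y, adj x y && (A == [set x; y])]].

(* The graph without vertices is not connected: graphs are non-empty. *)
Definition graph_connected (G : sgraph) : bool :=
  (0 < #|G|) && [forall x : G, forall y : G, connect (@adj G) x y].

Definition acyclic (G : sgraph) : Prop :=
  forall c : seq G, 2 < size c -> ~ ucycle (@adj G) c.

Definition is_tree (G : sgraph) : Prop := graph_connected G /\ acyclic G.

Section Induced.
Variables (G : sgraph) (S : {set G}).

Definition induced_adj : rel {x : G | x \in S} :=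
  fun x y => adj (val x) (val y).

Lemma induced_adj_sym : symmetric induced_adj.
Proof. by move=> x y; apply: adj_sym. Qed.

Lemma induced_adj_irrefl : irreflexive induced_adj.
Proof. by move=> x; apply: adj_irrefl. Qed.

Definition induced : sgraph := SGraph induced_adj_sym induced_adj_irrefl.

End Induced.

Definition delete (G : sgraph) (S : {set G}) : sgraph := induced (~: S).

Definition closed_nbhd (G : sgraph) (v : G) : {set G} :=
  [set w | (w == v) || adj v w].

Definition dominating (G : sgraph) (S : {set G}) : bool :=
  [forall v : G, closed_nbhd v :&: S != set0].

Definition connected_dominating (G : sgraph) (S : {set G}) : bool :=
  dominating S && graph_connected (induced S).

Definition outer_connected_dominating (G : sgraph) (S : {set G}) : bool :=
  dominating S && graph_connected (delete S).

(* Since #|S| <= #|T|, the default #|T| does not affect the minimum when some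
   S satisfies P; it is the value when no S does. *)
Definition min_card (T : finType) (P : pred {set T}) : nat :=
  \big[minn/#|T|]_(S : {set T} | P S) #|S|.

Lemma min_card_le (T : finType) (P : pred {set T}) (S : {set T}) :
  P S -> min_card P <= #|S|.
Proof.
move=> PS; rewrite /min_card; have := mem_index_enum S.
elim: (index_enum _) => //= A r IHr; rewrite inE big_cons => /orP[/eqP<-|rS].
  by rewrite PS geq_minl.
case: (P A); last exact: IHr.
by rewrite geq_min IHr ?orbT.
Qed.

Lemma min_card_attained (T : finType) (P : pred {set T}) :
  (exists S, P S) -> exists2 S, P S & #|S| = min_card P.
Proof.
case=> S0 PS0; have [S PS Smin] := @arg_minnP _ S0 P (fun S => #|S|) PS0.
exists S => //; apply/eqP; rewrite eqn_leq min_card_le // andbT /min_card.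
elim/big_ind: _ => [|a b Ha Hb|]; first exact: max_card.
  by rewrite leq_min Ha.
exact: Smin.
Qed.

Definition connected_domination_number (G : sgraph) : nat :=
  min_card (@connected_dominating G).

Definition outer_connected_domination_number (G : sgraph) : nat :=
  min_card (@outer_connected_dominating G).

Section Middle.
Variable G : sgraph.

Definition middle_vertex : finType := (G + {f : {set G} | f \in edges G})%type.

Definition middle_adj : rel middle_vertex := fun x y =>
  match x, y with
  | inl _, inl _ => false
  | inl v, inr f => v \in val f
  | inr f, inl v => v \in val f
  | inr f, inr g => (f != g) && (val f :&: val g != set0)
  end.

Lemma middle_adj_sym : symmetric middle_adj.
Proof. by move=> [v|f] [w|g] //=; rewrite eq_sym setIC. Qed.

Lemma middle_adj_irrefl : irreflexive middle_adj.
Proof. by move=> [v|f] //=; rewrite eqxx. Qed.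

Definition middle_graph : sgraph := SGraph middle_adj_sym middle_adj_irrefl.

End Middle.

(* Main.v *)
Require Import Defs.
From mathcomp Require Import all_boot.

(** Send each vertex of the middle graph to a set of vertices of [G]: a vertex
    [v] to [{v}], an edge to its two ends.  Two vertices of [M(G)] are adjacent
    exactly when they differ and these sets meet ([middle_adjE]), so [M(G)] is
    an intersection graph of sets of one or two elements, and a set dominates
    [M(G)] exactly when its sets cover [V(G)] ([dominating_middleE]).

    This settles the two numbers.  Covering [n] points by pairs takes at least
    [n/2] of them, which bounds every dominating set from below.  A connected
    family of [k] pairs covers at most [k + 1] points, since each new pair meets
    an old one ([card_bigcup_connected]), and in a connected graph one can grow
    a connected family of edges that gains a new vertex with each edge
    ([connected_dominating_middle]); hence the connected domination number of
    [M(G)] is exactly [n - 1].  Finally, when [G] has a cycle, an edge [uv] of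
    it can be removed without disconnecting [G]; then [uv] together with the
    vertices other than [u] and [v] dominates, and what is left of [M(G)], the
    other edges along with [u] and [v], is connected
    ([outer_connected_dominating_middle]).  So the outer-connected domination
    number lies between [n/2] and [n - 1], and the four inequalities follow.

    Connectedness of induced subgraphs is used in its cut form: a set that is closed under
    adjacency and not empty contains everything. *)

Set Implicit Arguments.
Unset Strict Implicit.
Unset Printing Implicit Defensive.

(** * Cuts *)

Lemma connect_closed (T : finType) (e : rel T) (A : {set T}) (x y : T) :
  {in A, forall a b, e a b -> b \in A} -> x \in A -> connect e x y -> y \in A.
Proof.
move=> clA Ax /connectP[p pP ->]; elim: p x Ax pP => //= z p IHp x Ax.
by case/andP=> /(clA _ Ax) Az; apply: IHp.
Qed.

(** Stating cuts with sets of the ambient graph avoids the subtype of [induced]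
    in all later arguments. *)
Lemma induced_connectedP (G : sgraph) (S : {set G}) :
  graph_connected (induced S) <->
  S != set0 /\
  (forall (A : {set G}) x, x \in A -> x \in S ->
     (forall a b, a \in A -> a \in S -> b \in S -> adj a b -> b \in A) ->
   S \subset A).
Proof.
split.
  case/andP=> /card_gt0P[[x0 Sx0] _] /forallP conS.
  split; first by apply/set0Pn; exists x0.
  move=> A x Ax Sx clA; apply/subsetP=> y Sy.
  have := forallP (conS (Sub x Sx)) (Sub y Sy).
  move/(@connect_closed _ _ [set z | val z \in A]).
  by rewrite !inE; apply=> // a Aa b ab; move: Aa; rewrite !inE => Aa;
     apply: clA ab => //; apply: valP.
case=> /set0Pn[x0 Sx0] cutS; apply/andP; split.
  by apply/card_gt0P; exists (Sub x0 Sx0).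
apply/forallP=> -[x Sx]; apply/forallP=> -[y Sy].
(* The component of x, pushed forward to the ambient graph. *)
set A := [set val z | z in connect (@adj (induced S)) (Sub x Sx)].
suff /subsetP/(_ y Sy)/imsetP[z xz yz] : S \subset A.
  by rewrite (_ : exist _ y Sy = z) //; apply: val_inj.
apply: (cutS A x) => //.
  by apply/imsetP; exists (Sub x Sx); rewrite // inE connect0.
move=> _ b /imsetP[a xa ->] _ Sb ab; apply/imsetP; exists (Sub b Sb) => //.
by rewrite inE; apply: connect_trans xa _; apply: connect1.
Qed.

Lemma induced_connected1 (G : sgraph) (x : G) :
  graph_connected (induced [set x]).
Proof.
apply/induced_connectedP; split; first by apply/set0Pn; exists x; rewrite inE.
by move=> A y Ay; rewrite inE sub1set => /eqP<-.
Qed.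

Lemma induced_connectedU1 (G : sgraph) (S : {set G}) (x y : G) :
  graph_connected (induced S) -> x \in S -> adj x y ->
  graph_connected (induced (y |: S)).
Proof.
case/induced_connectedP=> _ cutS Sx xy; apply/induced_connectedP; split.
  by apply/set0Pn; exists y; rewrite setU11.
move=> A z Az zyS clA.
have clAS a b : a \in A -> a \in S -> b \in S -> adj a b -> b \in A.
  by move=> Aa Sa Sb; apply: clA; rewrite ?inE ?Sa ?Sb ?orbT.
have Ax : x \in A.
  case/setU1P: zyS Az => [-> Ay|Sz Az].
    by apply: (clA y x) => //; rewrite ?setU11 ?inE ?Sx ?orbT // adj_sym.
  by apply: (subsetP (cutS A z Az Sz clAS)).
rewrite subUset sub1set (cutS A x) // andbT.
by apply: (clA x y) => //; rewrite ?setU11 // inE Sx orbT.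
Qed.

(** * Covering by small sets *)

Lemma card_bigcup_le (I T : finType) (S : {set I}) (C : I -> {set T}) (k : nat) :
  (forall i, #|C i| <= k) -> #|\bigcup_(i in S) C i| <= k * #|S|.
Proof.
move=> leC; rewrite mulnC -sum_nat_const.
elim/big_rec2: _ => [|i m U _ leU]; first by rewrite cards0.
by apply: leq_trans (leq_card_setU _ _) _; apply: leq_add.
Qed.

(** The pieces can be added one at a time, each meeting what is already covered,
    so that all but the first contribute at most one new point.  The proof takes
    a largest subset for which the bound holds. *)
Lemma card_bigcup_connected (G : sgraph) (T : finType) (C : G -> {set T})
    (S : {set G}) :
  (forall x, #|C x| <= 2) -> (forall x y, adj x y -> C x :&: C y != set0) ->
  graph_connected (induced S) -> #|\bigcup_(x in S) C x| <= #|S|.+1.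
Proof.
move=> leC meetC /induced_connectedP[/set0Pn[x0 Sx0] cutS].
pose P (A : {set G}) :=
  [&& A \subset S, x0 \in A & #|\bigcup_(x in A) C x| <= #|A|.+1].
have P0 : P [set x0] by rewrite /P sub1set Sx0 set11 big_set1 cards1 leC.
have [A /and3P[sAS Ax0 leA] maxA] := arg_maxnP (fun A : {set G} => #|A|) P0.
suff sSA : S \subset A by have/eqP <- : A == S by rewrite eqEsubset sAS.
apply: (cutS A x0) => // a b Aa _ Sb ab; apply: contraT => nAb.
have: P (b |: A).
  rewrite /P subUset sub1set Sb sAS !inE Ax0 orbT cardsU1 nAb big_setU1 //=.
  set U := \bigcup_(x in A) C x in leA *.
  have I_gt0 : 0 < #|C b :&: U|.
    have /set0Pn[t /setIP[at_ bt]] := meetC _ _ ab.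
    by apply/card_gt0P; exists t; rewrite inE bt; apply/bigcupP; exists a.
  rewrite cardsU leq_subLR (leq_trans (leq_add (leC b) leA)) //.
  by rewrite add1n -[X in _ <= X]addSnnS leq_add2r.
by move/maxA; rewrite /= cardsU1 nAb add1n ltnn.
Qed.

(** * The middle graph as an intersection graph *)

Section MiddleGraph.
Variable G : sgraph.

Definition ends (x : middle_graph G) : {set G} :=
  match x with inl v => [set v] | inr f => val f end.

Lemma edgesP (A : {set G}) :
  reflect (exists x y, adj x y /\ A = [set x; y]) (A \in edges G).
Proof.
rewrite inE; apply: (iffP existsP) => [[x /existsP[y /andP[xy /eqP->]]]|].
  by exists x, y.
by case=> x [y [xy ->]]; exists x; apply/existsP; exists y; rewrite xy eqxx.
Qed.

Lemma mem_edges (x y : G) : adj x y -> [set x; y] \in edges G.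
Proof. by move=> xy; apply/edgesP; exists x, y. Qed.

Definition edge_vertex (x y : G) (xy : adj x y) : middle_graph G :=
  inr (Sub [set x; y] (mem_edges xy)).

Lemma card_ends x : #|ends x| <= 2.
Proof.
case: x => [v|[f /= /edgesP[x [y [_ ->]]]]]; first by rewrite /= cards1.
by rewrite cards2; case: eqP.
Qed.

Lemma ends_neq0 x : ends x != set0.
Proof.
case: x => [v|[f /= /edgesP[x [y [_ ->]]]]]; apply/set0Pn.
  by exists v; rewrite inE.
by exists x; rewrite !inE eqxx.
Qed.

Lemma middle_adjE (x y : middle_graph G) :
  adj x y = (x != y) && (ends x :&: ends y != set0).
Proof.
have sI v (A : {set G}) : ([set v] :&: A != set0) = (v \in A).
  apply/set0Pn/idP => [[w /setIP[/set1P->]] //|Av].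
  by exists v; rewrite !inE eqxx.
case: x y => [v|f] [w|g] //=; rewrite ?sI //; last by rewrite setIC sI.
by rewrite inE (inj_eq (@inl_inj _ _)) andNb.
Qed.

Lemma adj_ends (x y : middle_graph G) (v : G) :
  v \in ends x -> v \in ends y -> x != y -> adj x y.
Proof.
by move=> xv yv nxy; rewrite middle_adjE nxy; apply/set0Pn; exists v; apply/setIP.
Qed.

Lemma dominating_middleE (S : {set middle_graph G}) :
  dominating S = (\bigcup_(x in S) ends x == setT).
Proof.
apply/forallP/eqP => [domS|covS x].
  apply/setP=> v; rewrite [RHS]inE; have /set0Pn[y] := domS (inl v).
  rewrite !inE => /andP[vy Sy]; apply/bigcupP; exists y => //.
  case/orP: vy => [/eqP->|]; first by rewrite inE.
  by case: y Sy.
have /set0Pn[v xv] := ends_neq0 x.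
have /bigcupP[y Sy yv] : v \in \bigcup_(x in S) ends x by rewrite covS inE.
apply/set0Pn; exists y; rewrite !inE Sy andbT.
by case: eqVneq => //= nyx; apply: adj_ends xv yv _; rewrite eq_sym.
Qed.

(** * Dominating sets of the middle graph *)

Lemma card_dominating_middle (S : {set middle_graph G}) :
  dominating S -> uphalf #|G| <= #|S|.
Proof.
rewrite dominating_middleE => /eqP covS; rewrite leq_uphalf_double -mul2n.
by rewrite -cardsT -covS; apply: card_bigcup_le card_ends.
Qed.

Lemma card_connected_dominating_middle (S : {set middle_graph G}) :
  connected_dominating S -> #|G| <= #|S|.+1.
Proof.
case/andP; rewrite dominating_middleE => /eqP covS conS.
rewrite -cardsT -covS; apply: card_bigcup_connected conS => [|x y].
  exact: card_ends.
by rewrite middle_adjE => /andP[].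
Qed.

(** The edge set of a spanning tree, obtained as a largest connected family that
    covers more vertices than it has members: if some vertex were not covered,
    an edge leaving the covered part could still be added. *)
Lemma connected_dominating_middle :
  1 < #|G| -> graph_connected G ->
  exists2 S : {set middle_graph G}, connected_dominating S & #|S| < #|G|.
Proof.
move=> /card_gt1P[x0 [y0 [_ _ nxy0]]] /andP[_ /forallP conG].
have cutG (A : {set G}) x y :
    x \in A -> y \notin A -> exists a b, [/\ a \in A, b \notin A & adj a b].
  move=> Ax nAy; suff /existsP[a /existsP[b /and3P[]]] :
    [exists a, exists b, [&& a \in A, b \notin A & adj a b]] by exists a, b.
  apply: contraR nAy => noAB.
  apply: connect_closed Ax (forallP (conG x) y) => a Aa b ab.
  apply: contraR noAB => nAb; apply/existsP; exists a; apply/existsP; exists b.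
  by rewrite Aa nAb.
pose P (S : {set middle_graph G}) :=
  graph_connected (induced S) && (#|S| < #|\bigcup_(x in S) ends x|).
have [a0 [b0 [_ _ ab0]]] :
    exists a b, [/\ a \in [set x0], b \notin [set x0] & adj a b].
  by apply: (cutG _ x0 y0); rewrite inE // eq_sym.
have P0 : P [set edge_vertex ab0].
  rewrite /P induced_connected1 cards1 big_set1 /= cards2.
  by case: eqP ab0 => // ->; rewrite adj_irrefl.
have [S /andP[conS ltS] maxS] :=
  arg_maxnP (fun S : {set middle_graph G} => #|S|) P0.
set U := \bigcup_(x in S) ends x in ltS.
suff covS : U = setT.
  exists S; last by rewrite -cardsT -covS.
  by rewrite /connected_dominating dominating_middleE -/U covS eqxx.
apply/setP=> y; rewrite [RHS]inE; apply: contraT => nUy.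
have /card_gt0P[x Ux] : 0 < #|U| by apply: leq_ltn_trans ltS.
have [a [b [Ua nUb ab]]] := cutG U x y Ux nUy.
have /bigcupP[z Sz za] := Ua.
have nSab : edge_vertex ab \notin S.
  apply: contra nUb => Sab; apply/bigcupP.
  by exists (edge_vertex ab); rewrite //= !inE eqxx orbT.
have: P (edge_vertex ab |: S).
  rewrite /P (induced_connectedU1 (x := z)) //=.
    rewrite cardsU1 nSab add1n big_setU1 //= -/U.
    apply: leq_ltn_trans ltS _; apply: proper_card.
    rewrite properE subsetUr; apply/subsetPn; exists b => //.
    by rewrite !inE eqxx orbT.
  apply: (adj_ends (v := a)) => //=; first by rewrite !inE eqxx.
  by apply: contraNneq nSab => <-.
by move/maxS; rewrite /= cardsU1 nSab add1n ltnn.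
Qed.

Definition adj_without_edge (u v : G) : rel G :=
  [rel x y | adj x y && ([set x; y] != [set u; v])].

Lemma adj_without_edge_sym u v : symmetric (adj_without_edge u v).
Proof. by move=> x y; rewrite /adj_without_edge /= adj_sym setUC. Qed.

(** The rest of the cycle joins the ends of its first edge. *)
Lemma cycle_nonbridge (c : seq G) :
  2 < size c -> ucycle (@adj G) c ->
  exists u v, adj u v /\ connect (adj_without_edge u v) v u.
Proof.
case: c => [//|u [//|v [//|w p]]] _ /andP[].
rewrite [cycle _ _]/= => /andP[uv].
rewrite -[_ && _]/(path _ v (rcons (w :: p) u)).
move=> pathp uniqc; exists u, v; split=> //.
apply/connectP; exists (rcons (w :: p) u); last by rewrite last_rcons.
move: pathp uniqc; rewrite !rcons_path => /andP[pathp lastu].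
rewrite cons_uniq => /andP[nup /andP[nvp _]].
(* Inner edges of the path avoid [u]; its last edge avoids [v], because the
   path has an inner vertex. *)
have inner q : forall x, u \notin x :: q -> path (@adj G) x q ->
    path (adj_without_edge u v) x q.
  elim: q => //= z q IHq x; rewrite inE negb_or => /andP[nux nuzq].
  case/andP=> xz pathq; rewrite IHq // andbT /adj_without_edge /= xz /=.
  apply/negP=> /eqP/setP/(_ u); rewrite !inE eqxx (negPf nux) /=.
  by move: nuzq; rewrite inE negb_or => /andP[/negPf->].
rewrite inner //= /adj_without_edge /= lastu /=.
apply: contra nvp => /eqP/setP/(_ v); rewrite !in_set2 eqxx orbT.
case/orP=> /eqP vE; first by rewrite vE mem_last.
by rewrite vE mem_head in nup.
Qed.

(** The part of [M(G)] outside the dominating set consists of [u], [v] and the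
    edges other than [uv].  A nonempty set [A] closed in it determines the set
    [B] of vertices with an edge in [A]; edges at a common vertex being adjacent,
    [B] is closed in [G] minus [uv], hence is everything. *)
Lemma outer_connected_dominating_middle (u v : G) :
  graph_connected G -> adj u v -> connect (adj_without_edge u v) v u ->
  exists2 S : {set middle_graph G},
    outer_connected_dominating S & #|S| = #|G|.-1.
Proof.
case/andP=> _ /forallP conG uv vu.
have nuv : u != v by apply: contraTneq uv => ->; rewrite adj_irrefl.
have conB x y : connect (adj_without_edge u v) x y.
  apply: connect_sub (forallP (conG x) y) => a b ab.
  have [/setP eab|nab] := eqVneq [set a; b] [set u; v]; last first.
    by apply: connect1; rewrite /adj_without_edge /= ab.
  have := eab a; have := eab b; rewrite !inE !eqxx orbT /=.
  have uv' : connect (adj_without_edge u v) u v.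
    by rewrite (sym_connect_sym (@adj_without_edge_sym u v)).
  by move=> /esym/pred2P[]-> /esym/pred2P[]->.
pose e := edge_vertex uv.
pose S : {set middle_graph G} := e |: [set inl w | w in ~: [set u; v]].
have Sinl w : (inl w \in S) = (w \notin [set u; v]).
  rewrite -in_setC /S in_setU1 /=.
  by apply/imsetP/idP => [[w' w'uv [->]] //|wuv]; exists w.
have Sinr (f : {f | f \in edges G}) : (inr f \in S) = (val f == [set u; v]).
  rewrite /S in_setU1 orbC; case: imsetP => [[]//|_] /=.
  by apply/eqP/eqP => [[->]//|fuv]; congr inr; apply: val_inj.
exists S; last first.
  rewrite cardsU1 card_imset; last by move=> ? ? [].
  have -> : e \notin [set inl w | w in ~: [set u; v]] by apply/imsetP => -[].
  by have := cardsC [set u; v]; rewrite cards2 nuv => <-.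
apply/andP; split.
  rewrite dominating_middleE; apply/eqP/setP=> x; rewrite [RHS]inE.
  apply/bigcupP; case: (boolP (x \in [set u; v])) => xuv.
    by exists e; rewrite // Sinr.
  by exists (inl x); rewrite ?Sinl // inE.
(* Since [u] and [v] differ, one of them is not [x]; a path from [x] to it
   then starts with an edge other than [uv]. *)
have edge_at x : exists y, adj_without_edge u v x y.
  pose w := if x == u then v else u.
  have nxw : x != w.
    by rewrite /w; case: (eqVneq x u) => // ->.
  case/connectP: (conB x w) => [[|y p] /=].
    by move=> _ wx; rewrite wx eqxx in nxw.
  by case/andP=> xy _ _; exists y.
apply/induced_connectedP; split.
  by apply/set0Pn; exists (inl u); rewrite in_setC Sinl negbK !inE eqxx.
move=> A z Az nSz clA.
pose B := [set x | [exists f : {f | f \in edges G},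
  [&& inr f \in A, inr f \notin S & x \in val f]]].
have closeA x (y : middle_graph G) :
    x \in B -> y \notin S -> x \in ends y -> y \in A.
  rewrite inE => /existsP[f /and3P[Af nSf fx]] nSy yx.
  have [<-//|nfy] := eqVneq (inr f) y.
  by apply: (clA (inr f)); rewrite ?in_setC //; apply: (adj_ends (v := x)).
have but_edge x y (xy : adj x y) :
    [set x; y] != [set u; v] -> edge_vertex xy \notin S.
  by rewrite Sinr.
have clB : {in B, forall x y, adj_without_edge u v x y -> y \in B}.
  move=> x Bx y /andP[xy nxy]; have nS := but_edge _ _ xy nxy.
  rewrite inE; apply/existsP; exists (Sub [set x; y] (mem_edges xy)).
  by rewrite nS (closeA x _ Bx nS) /= !inE ?eqxx ?orbT.
have [x Bx] : exists x, x \in B.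
  rewrite in_setC in nSz.
  case: z Az nSz => [w|f] Az nSz; last first.
    have /set0Pn[x fx] := ends_neq0 (inr f).
    by exists x; rewrite inE; apply/existsP; exists f; rewrite Az nSz.
  have [y /andP[wy nwy]] := edge_at w; have nS := but_edge _ _ wy nwy.
  exists w; rewrite inE; apply/existsP.
  exists (Sub [set w; y] (mem_edges wy)); rewrite nS /= !inE eqxx andbT.
  apply: (clA (inl w)); rewrite ?in_setC //.
  by rewrite /= !inE eqxx.
apply/subsetP=> y; rewrite in_setC => nSy.
have /set0Pn[w yw] := ends_neq0 y.
exact: closeA (connect_closed clB Bx (conB x w)) nSy yw.
Qed.

End MiddleGraph.

Theorem corollary6p2 (G : sgraph) (n : nat)
    (card_G : #|G| = n) (n_ge4 : 4 <= n)
    (G_connected : graph_connected G) (G_not_tree : ~ is_tree G) :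
  (n + uphalf n - 1
     <= connected_domination_number (middle_graph G)
        + outer_connected_domination_number (middle_graph G)
     <= 2 * n - 2)
  /\
  (uphalf n * (n - 1)
     <= connected_domination_number (middle_graph G)
        * outer_connected_domination_number (middle_graph G)
     <= (n - 1) ^ 2).
Proof.
have n_gt1 : 1 < #|G| by rewrite card_G; apply: leq_trans n_ge4.
have -> : connected_domination_number (middle_graph G) = n - 1.
  have [S cdS ltS] := connected_dominating_middle n_gt1 G_connected.
  have [D cdD Dmin] := min_card_attained (ex_intro _ S cdS).
  have leD := min_card_le cdS; rewrite -Dmin in leD.
  have := card_connected_dominating_middle cdD.
  rewrite /connected_domination_number -Dmin subn1 -card_G => leG.
  apply/eqP; rewrite eqn_leq -ltnS prednK ?(ltnW n_gt1) //.
  by rewrite (leq_ltn_trans leD ltS) -subn1 leq_subLR add1n.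
set b := outer_connected_domination_number _.
suff /andP[leb geb] : uphalf n <= b <= n - 1.
  rewrite [uphalf n * _]mulnC leq_mul2l leb orbT -mulnn leq_mul2l geb orbT.
  rewrite -addnBAC ?(leq_trans _ n_ge4) // leq_add2l leb.
  have -> : 2 * n - 2 = (n - 1) + (n - 1) by rewrite addnn -mul2n mulnBr muln1.
  by rewrite leq_add2l geb.
have [S ocS cardS] :
  exists2 S : {set middle_graph G}, outer_connected_dominating S & #|S| = #|G|.-1.
  (* The existence of such a set is decidable, so it may be proved by
     contradiction: without one, [G] has no cycle and is a tree. *)
  suff /existsP[S /andP[ocS /eqP cS]] : [exists S : {set middle_graph G},
      outer_connected_dominating S && (#|S| == #|G|.-1)] by exists S.
  apply: contraT => noS; case: G_not_tree; split=> // c c_gt2 cycle_c.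
  have [u [v [uv vu]]] := cycle_nonbridge c_gt2 cycle_c.
  have [S ocS cS] := outer_connected_dominating_middle G_connected uv vu.
  by case/existsP: noS; exists S; rewrite ocS cS eqxx.
have [D ocD Dmin] := min_card_attained (ex_intro _ S ocS).
have := min_card_le ocS; rewrite cardS card_G -subn1 => ->.
rewrite andbT /b /outer_connected_domination_number -Dmin -card_G.
by case/andP: ocD => /card_dominating_middle.
Qed.
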